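(* Let $\mathcal T\in\mathbb R^{n^{\times d}}_{ps,+}$ be weakly irreducible. Let $u>0$ satisfy $\mathcal T(u)=\rho(\mathcal T)u^{\circ(d-1)}$, let $A=\operatorname{diag}(u)^{-(d-2)}D\mathcal T(u)$, and let $w>0$ be the unique vector with $A^\top w=(d-1)\rho(\mathcal T)w$ and $w^\top u=1$. Let $y=(y_1,\dots,y_n)^\top>0$. Then $$\rho(\operatorname{diag}(y)\circ\mathcal T)\ \ge\ \rho(\mathcal T)\prod_{i=1}^n y_i^{u_iw_i}.$$ If furthermore $\mathcal T$ is a symmetric tensor and $\sum_{i=1}^n u_i^d=1$, then $$\rho(\operatorname{diag}(y)\circ\mathcal T)\ \ge\ \rho(\mathcal T)\prod_{i=1}^n y_i^{u_i^d}.$$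
   Context: Let $n\ge1$, $d\ge3$ be integers, $[n]=\{1,\dots,n\}$. $\mathbb R^{n^{\times d}}_{ps,+}$ is the set of tensors $\mathcal T=[t_{i_1,\dots,i_d}]$, $i_1,\dots,i_d\in[n]$, with nonnegative real entries symmetric in the last $d-1$ indices; $\mathcal T$ is symmetric if its entries are invariant under all permutations of the $d$ indices. For $x\in\mathbb C^n$, $\mathcal T(x)_i=\sum_{i_2,\dots,i_d\in[n]}t_{i,i_2,\dots,i_d}x_{i_2}\cdots x_{i_d}$, and $x^{\circ p}=(x_1^p,\dots,x_n^p)^\top$. An eigenvalue of $\mathcal T$ is $\lambda\in\mathbb C$ with $\mathcal T(x)=\lambda x^{\circ(d-1)}$ for some nonzero $x\in\mathbb C^n$; $\rho(\mathcal T)$ is the maximum modulus of the eigenvalues. For $y\in\mathbb R^n$, $\operatorname{diag}(y)\circ\mathcal T:=[y_{i_1}t_{i_1,\dots,i_d}]$. For vectors, $x>0$ means all entries are positive. $\mathcal T$ is weakly irreducible if the digraph on $[n]$ with an edge $(i,j)$ whenever $t_{i,j_1,\dots,j_{d-1}}>0$ for some $j_1,\dots,j_{d-1}$ with $j\in\{j_1,\dots,j_{d-1}\}$ is strongly connected. In that case a vector $u>0$ with $\mathcal T(u)=\rho(\mathcal T)u^{\circ(d-1)}$ exists and is unique up to positive scaling. $D\mathcal T(u)\in\mathbb R^{n\times n}$ has entries $D\mathcal T(u)_{ij}=(d-1)\sum_{i_3,\dots,i_d}t_{i,j,i_3,\dots,i_d}u_{i_3}\cdots u_{i_d}$; the matrix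 $A$ is nonnegative irreducible with $Au=(d-1)\rho(\mathcal T)u$, so $w$ exists and is unique. *)

(* Defs.v *)
From HB Require Import structures.
From mathcomp Require Import all_boot all_order all_algebra.
From mathcomp Require Import all_classical all_reals all_analysis.
From mathcomp Require Import complex.

Set Implicit Arguments.
Unset Strict Implicit.
Unset Printing Implicit Defensive.

Import Order.TTheory GRing.Theory Num.Theory.
Local Open Scope classical_set_scope.
Local Open Scope ring_scope.
Local Open Scope complex_scope.

(* An order-d tensor of dimension n >= 1, with d >= 1. The first index is kept
   apart from the d - 1 others: t_{i_1, i_2, ..., i_d} is [T i_1 s], with [s]
   the tuple (i_2, ..., i_d). *)
Definition tensor (K : Type) (n d : nat) : Type :=
  'I_n -> (d.-1).-tuple 'I_n -> K.

Section TensorMaps.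
Context {K : comNzRingType} {n d : nat}.
Implicit Types (T : tensor K n d) (x y : 'cV[K]_n).

Definition tapply T x : 'cV[K]_n :=
  \col_i \sum_(s : (d.-1).-tuple 'I_n) T i s * \prod_(k <- s) x k 0.

Definition hpow x (p : nat) : 'cV[K]_n := map_mx (fun a => a ^+ p) x.

Definition diag_tensor y T : tensor K n d := fun i s => y i 0 * T i s.

(* The (i, j) entry sums over the tuples (j, i_3, ..., i_d). *)
Definition tjac T x : 'M[K]_n :=
  \matrix_(i, j) ((d.-1)%:R *
    \sum_(s : (d.-1).-tuple 'I_n | ohead s == Some j)
       T i s * \prod_(k <- behead s) x k 0).

End TensorMaps.

Section Real.
Context {R : realType} {n d : nat}.
Implicit Types (T : tensor R n d).

Definition nonneg_tensor T : Prop := forall i s, 0 <= T i s.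

Definition partially_symmetric T : Prop :=
  forall i (s s' : (d.-1).-tuple 'I_n), perm_eq s s' -> T i s = T i s'.

Definition symmetric_tensor T : Prop :=
  forall i i' (s s' : (d.-1).-tuple 'I_n),
    perm_eq (i :: s) (i' :: s') -> T i s = T i' s'.

Definition tensor_edge T : rel 'I_n :=
  fun i j => [exists s : (d.-1).-tuple 'I_n, (0 < T i s) && (j \in tval s)].

(* [connect] is the reflexive-transitive closure, so that a digraph with a
   single vertex is strongly connected even without a loop. *)
Definition weakly_irreducible T : Prop :=
  forall i j, connect (tensor_edge T) i j.

Definition tensor_eigenvalue T (lambda : R[i]) : Prop :=
  exists2 x : 'cV[R[i]]_n, x != 0 &
    tapply (fun i s => (T i s)%:C : R[i]) x = lambda *: hpow x d.-1.

(* The norm of [R[i]] takes its values in [R[i]], hence the embedding [r%:C]. *)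
Definition eigen_moduli T : set R :=
  [set r | exists2 lambda : R[i], tensor_eigenvalue T lambda & `|lambda| = r%:C].

(* [A `&` ubound A] is the set of maxima of [A]; the default value 0 is only
   taken when there is no maximum. *)
Definition spectral_radius T : R :=
  xget 0 (eigen_moduli T `&` ubound (eigen_moduli T)).

Definition positive_vector (x : 'cV[R]_n) : Prop := forall i, 0 < x i 0.

Definition scaled_jac T (u : 'cV[R]_n) : 'M[R]_n :=
  diag_mx (\row_i (u i 0) ^- (d - 2)) *m tjac T u.

End Real.

Lemma spectral_radius_max {R : realType} {n d : nat} (T : tensor R n d) (r : R) :
  eigen_moduli T r -> ubound (eigen_moduli T) r -> spectral_radius T = r.
Proof.
move=> Tr ubr; apply: xget_unique => [//|s [Ts ubs]].
by apply/eqP; rewrite eq_le (ubr _ Ts) (ubs _ Tr).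
Qed.

(* Main.v *)
(* Put S = diag(y) o T.  Minimising the Collatz-Wielandt number
   max_i S(x)_i / x_i^(d-1) over x > 0 gives a positive eigenvector v of S: after
   normalising min x = 1, bounds propagate along the edges of the digraph, so the
   sublevel sets are compact; and a minimiser that is not an eigenvector could be
   improved by shrinking its non-tight coordinates one at a time.  Its eigenvalue r
   is the spectral radius of S.
   In logarithmic coordinates, x |-> \sum_i u_i w_i ln (T(x)_i / x_i^(d-1)) is
   convex, and the equation for w says that u is a critical point of it, so its
   minimum is ln rho(T).  Evaluating it at v gives the inequality.  When T is
   symmetric, w = u^(d-1) solves the equation for w. *)
Require Import Defs.
From mathcomp Require Import all_boot all_order all_algebra.
From mathcomp Require Import all_classical all_reals all_analysis.
From mathcomp Require Import perm complex ring lra zify.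

Set Implicit Arguments.
Unset Strict Implicit.
Unset Printing Implicit Defensive.

Import Order.TTheory GRing.Theory Num.Theory numFieldNormedType.Exports.
Local Open Scope ring_scope.

(** * Preliminaries on digraphs and powers *)

Lemma connect_exit (V : finType) (e : rel V) (A : {pred V}) a b :
  connect e a b -> a \in A -> b \notin A ->
  exists j i, [/\ j \in A, i \notin A & e j i].
Proof.
move=> /connectP[p]; elim: p a => [|c p IH] a /= => [_ -> -> //|].
move=> /andP[ac cp] bE aA bA; have [cA|cA] := boolP (c \in A).
  exact: IH cp bE cA bA.
by exists a, c.
Qed.

Lemma exists_expr_gt (R : realType) (m : nat) (q : R) : q < 1 ->
  exists2 c : R, 0 < c < 1 & q < c ^+ m.
Proof.
(* With [c = expR (- t)], [c ^+ m >= 1 - m t > q] because [t * m.+1 < 1 - q]; dividing by [m.+1]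
   also covers [m = 0]. *)
move=> q1; pose t := (1 - q) / 2 / m.+1%:R.
have t0 : 0 < t by rewrite !divr_gt0 ?subr_gt0.
exists (expR (- t)); first by rewrite expR_gt0 expR_lt1 oppr_lt0.
rewrite -expRM_natl; apply: lt_le_trans (expR_ge1Dx _).
have : t * m.+1%:R < 1 - q.
  by rewrite divfK ?pnatr_eq0//; lra.
rewrite -natr1; nra.
Qed.

(** * Homogeneity and entrywise formulas *)

Section TensorAlgebra.
Context {K : comNzRingType} {n d : nat}.
Implicit Types (T : tensor K n d) (x y : 'cV[K]_n).

Lemma tapplyE T x i :
  tapply T x i 0 = \sum_s T i s * \prod_(k <- s) x k 0.
Proof. by rewrite mxE. Qed.

Lemma hpowE x p i : hpow x p i 0 = x i 0 ^+ p.
Proof. by rewrite mxE. Qed.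

Lemma tapplyZ T c x : tapply T (c *: x) = c ^+ d.-1 *: tapply T x.
Proof.
apply/colP => i; rewrite [RHS]mxE !tapplyE mulr_sumr; apply: eq_bigr => s _.
rewrite mulrCA; congr (_ * _).
under eq_bigr do rewrite mxE.
rewrite big_split; congr (_ * _).
by rewrite big_const_seq iter_mulr_1 count_predT size_tuple.
Qed.

Lemma tapply_eigen T lam x p i : tapply T x = lam *: hpow x p ->
  tapply T x i 0 = lam * x i 0 ^+ p.
Proof. by move=> ->; rewrite mxE hpowE. Qed.

Lemma tapply_diag y T x i :
  tapply (diag_tensor y T) x i 0 = y i 0 * tapply T x i 0.
Proof.
rewrite !tapplyE mulr_sumr.
by apply: eq_bigr => s _; rewrite /diag_tensor mulrA.
Qed.

End TensorAlgebra.

(** * Monotonicity and bounds on the moduli of eigenvalues *)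

Section NonnegativeTensor.
Context {R : realType} {n d : nat}.
Variable S : tensor R n d.
Hypothesis S_ge0 : nonneg_tensor S.
Implicit Types (x z v : 'cV[R]_n) (i j k : 'I_n).

Lemma ler_tapply x z i : (forall k, 0 <= x k 0 <= z k 0) ->
  tapply S x i 0 <= tapply S z i 0.
Proof.
move=> xz; rewrite !tapplyE; apply: ler_sum => s _.
by apply: ler_wpM2l; [exact: S_ge0 | apply: ler_prod].
Qed.

Lemma tapply_ge0 x i : (forall k, 0 <= x k 0) -> 0 <= tapply S x i 0.
Proof.
move=> x0; rewrite tapplyE; apply: sumr_ge0 => s _.
by apply: mulr_ge0; [exact: S_ge0 | apply: prodr_ge0].
Qed.

Lemma ler_term_tapply x i s : (forall k, 0 <= x k 0) ->
  S i s * \prod_(k <- s) x k 0 <= tapply S x i 0.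
Proof.
move=> x0; rewrite tapplyE (bigD1 s)//= lerDl; apply: sumr_ge0 => t _.
by apply: mulr_ge0; [exact: S_ge0 | apply: prodr_ge0].
Qed.

(** The entrywise moduli of a complex eigenvector serve as [x], by the triangle inequality. *)
Lemma eigen_moduli_subinvariant r : eigen_moduli S r ->
  exists2 x : 'cV[R]_n, [/\ forall k, 0 <= x k 0 & exists k, 0 < x k 0] &
    forall i, r * x i 0 ^+ d.-1 <= tapply S x i 0.
Proof.
move=> [lam [x x0 lamx] lamr].
(* Norms live in [R[i]]; the real part brings them back to [R]. *)
pose a : 'cV[R]_n := \col_k complex.Re `|x k 0|.
have aE k : `|x k 0| = ((a k 0)%:C)%C by rewrite mxE normc_def.
have a0 k : 0 <= a k 0 by rewrite -lecR -aE normr_ge0.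
exists a; first split => //.
  have /cV0Pn [k xk] := x0; exists k.
  by rewrite -ltcR -aE normr_gt0.
move=> i; rewrite -lecR.
rewrite rmorphM rmorphXn /= -lamr -aE -normrX -normrM.
rewrite -(tapply_eigen i lamx) tapplyE; apply: le_trans (ler_norm_sum _ _ _) _.
rewrite tapplyE rmorph_sum /=; apply: ler_sum => s _.
rewrite normrM normr_prod rmorphM rmorph_prod /=.
by rewrite ger0_norm ?lecR ?S_ge0// (eq_bigr _ (fun k _ => aE k)).
Qed.

(* Collatz-Wielandt bound: compare at an index maximising [x i / v i]. *)
Lemma eigen_moduli_ubound v r : positive_vector v ->
  (forall i, tapply S v i 0 <= r * v i 0 ^+ d.-1) ->
  ubound (eigen_moduli S) r.
Proof.
move=> v0 Sv q /eigen_moduli_subinvariant [x [x0 [k xk]] Sx].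
have [i _ imax] := @arg_maxP _ _ _ k xpredT (fun i => x i 0 / v i 0) isT.
set M := x i 0 / v i 0 in imax.
have {}imax j : x j 0 / v j 0 <= M by exact: imax.
have M0 : 0 < M by apply: lt_le_trans (imax k); rewrite divr_gt0.
have xM j : 0 <= x j 0 <= (M *: v) j 0.
  by rewrite x0 mxE -ler_pdivrMr ?v0// imax.
have xi : x i 0 = M * v i 0 by rewrite /M mulfVK// gt_eqF.
(* By homogeneity, [x <= M v] gives [q x_i^(d-1) <= M^(d-1) r v_i^(d-1)]; as [x_i = M v_i > 0], the
   power cancels. *)
have := le_trans (Sx i) (ler_tapply _ xM).
rewrite tapplyZ mxE xi exprMn => h.
have {}h := le_trans h (ler_wpM2l (exprn_ge0 _ (ltW M0)) (Sv i)).
rewrite -(ler_pM2r (exprn_gt0 d.-1 (mulr_gt0 M0 (v0 i)))) exprMn.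
by apply: le_trans h _; rewrite mulrCA.
Qed.

(** The modulus [r] is attained at [v], seen as a complex vector, and bounds all others by
    [eigen_moduli_ubound]. *)
Lemma positive_eigenvector_spectral_radius v r : (0 < n)%N ->
  positive_vector v -> 0 <= r -> tapply S v = r *: hpow v d.-1 ->
  spectral_radius S = r.
Proof.
move=> n0 v0 r0 Sv; apply: spectral_radius_max; last first.
  by apply: eigen_moduli_ubound v0 _ => i; rewrite Sv mxE hpowE.
exists (r%:C)%C; last by rewrite ger0_norm ?lecR.
exists (map_mx (real_complex R) v).
  apply/cV0Pn; exists (Ordinal n0); rewrite mxE.
  by rewrite fmorph_eq0 gt_eqF.
apply/colP => i; rewrite tapplyE mxE hpowE mxE -rmorphXn -rmorphM /=.
rewrite -(tapply_eigen i Sv) tapplyE.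
rewrite rmorph_sum /=; apply: eq_bigr => s _; rewrite rmorphM rmorph_prod /=.
by congr (_ * _); apply: eq_bigr => k _; rewrite mxE.
Qed.

Lemma spectral_radius_ge0 : 0 <= spectral_radius S.
Proof.
(* Without a maximum the value is the default 0, which is nonnegative as well. *)
rewrite /spectral_radius; case: xgetP => // r _ [[l _ lr] _].
by rewrite -lecR -lr normr_ge0.
Qed.


(** * Strict monotonicity along edges and tight coordinates *)

Lemma tensor_edgeP i j :
  reflect (exists2 s : (d.-1).-tuple 'I_n, 0 < S i s & j \in tval s)
    (tensor_edge S i j).
Proof.
by apply: (iffP existsP) => [[s /andP[]]|[s Ss js]]; exists s => //; apply/andP.
Qed.

(** Since [x > 0], the other factors of a monomial containing [x_j] do not vanish, so that term
    grows strictly. One occurrence of [j] is split off, as [j] may recur in [s]. *)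
Lemma ltr_tapply x z i j : positive_vector x -> (forall k, x k 0 <= z k 0) ->
  tensor_edge S i j -> x j 0 < z j 0 -> tapply S x i 0 < tapply S z i 0.
Proof.
move=> x0 xz /tensor_edgeP[s Ss js] xzj; rewrite !tapplyE.
have xz' k : 0 <= x k 0 <= z k 0 by rewrite ltW ?x0 ?xz.
rewrite (bigD1 s)//= [ltRHS](bigD1 s)//=; apply: ltr_leD; last first.
  by apply: ler_sum => t _; apply: ler_wpM2l; [exact: S_ge0 | apply: ler_prod].
rewrite ltr_pM2l// !(big_rem j js) /=.
apply: (@le_lt_trans _ _ (x j 0 * \prod_(k <- rem j s) z k 0)).
  by rewrite ler_pM2l ?x0//; apply: ler_prod.
by rewrite ltr_pM2r// prodr_gt0// => k _; apply: lt_le_trans (xz k).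
Qed.

(** When [S(x) <= mu x^(d-1)] holds everywhere, these are the indices of equality. *)
Definition tight (mu : R) x : {set 'I_n} :=
  [set i | mu * x i 0 ^+ d.-1 <= tapply S x i 0].

Hypothesis S_irr : weakly_irreducible S.

(* Shrinking a coordinate that is not tight, but that a tight one depends on,
   makes the latter strict without creating new tight coordinates. *)
Lemma shrink_tight mu x a b : 0 < mu -> positive_vector x ->
  (forall i, tapply S x i 0 <= mu * x i 0 ^+ d.-1) ->
  a \in tight mu x -> b \notin tight mu x ->
  exists x', [/\ positive_vector x',
    forall i, tapply S x' i 0 <= mu * x' i 0 ^+ d.-1 &
    (#|tight mu x'| < #|tight mu x|)%N].
Proof.
move=> mu0 x0 Sx ax bx.
have [j [i [jx ix ji]]] := connect_exit (S_irr a b) ax bx.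
have {}ix' : tapply S x i 0 < mu * x i 0 ^+ d.-1.
  by rewrite ltNge; move: ix; rewrite inE.
(* [c] is so close to 1 that [i] stays strict: [S(x')_i <= S(x)_i < mu (c x_i)^(d-1)]. *)
have [c /andP[c0 c1] qc] : exists2 c : R, 0 < c < 1 &
    tapply S x i 0 / (mu * x i 0 ^+ d.-1) < c ^+ d.-1.
  by apply: exists_expr_gt; rewrite ltr_pdivrMr ?mul1r// mulr_gt0 ?exprn_gt0.
rewrite ltr_pdivrMr ?mulr_gt0 ?exprn_gt0// in qc.
pose x' : 'cV[R]_n := \col_k (if k == i then c * x k 0 else x k 0).
have x'0 : positive_vector x' by move=> k; rewrite mxE; case: ifP; rewrite ?mulr_gt0.
have x'x k : x' k 0 <= x k 0.
  by rewrite mxE; case: ifP => // _; rewrite ler_piMl ?ltW.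
have Sx' k : tapply S x' k 0 <= tapply S x k 0.
  by apply: ler_tapply => l; rewrite ltW ?x'0 ?x'x.
have x'iE : x' i 0 = c * x i 0 by rewrite mxE eqxx.
have x'i : tapply S x' i 0 < mu * x' i 0 ^+ d.-1.
  by rewrite x'iE exprMn mulrCA (le_lt_trans (Sx' i)).
have x'k k : k != i -> x' k 0 = x k 0 by rewrite mxE => /negbTE ->.
exists x'; split => // [k|].
  have [->|ki] := eqVneq k i; first exact: ltW.
  by rewrite x'k// (le_trans (Sx' k)).
apply/proper_card/properP; split.
  apply/fintype.subsetP => k; rewrite !inE.
  have [->|ki] := eqVneq k i; first by rewrite leNgt x'i.
  by rewrite x'k// => /le_trans; apply.
exists j => //; rewrite inE -ltNge x'k; last first.
  by move: jx; apply: contraTneq => ->.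
apply: lt_le_trans (Sx j); apply: ltr_tapply ji _ => //.
by rewrite x'iE gtr_pMl.
Qed.

(** Induction on the number of tight indices: if all are tight, [x] is an eigenvector; if none is,
    [x] is strict; otherwise [shrink_tight] lowers the number. *)
Lemma subinvariant_eigenvector_or_strict mu x : 0 <= mu -> positive_vector x ->
  (forall i, tapply S x i 0 <= mu * x i 0 ^+ d.-1) ->
  tapply S x = mu *: hpow x d.-1 \/
  exists2 x', positive_vector x' &
    forall i, tapply S x' i 0 < mu * x' i 0 ^+ d.-1.
Proof.
move=> mu0; have [k] := ubnP #|tight mu x|; elim: k x => // k IH x xk x0 Sx.
have [b bx|xT] := pickP [pred i | i \notin tight mu x]; last first.
  left; apply/colP => i; rewrite [RHS]mxE hpowE; apply/eqP; rewrite eq_le Sx.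
  by have := xT i; rewrite !inE => /negbFE.
have {}mu0 : 0 < mu.
  rewrite lt_neqAle mu0 andbT; apply: contraNneq bx => <-.
  by rewrite inE mul0r tapply_ge0// => i; exact/ltW.
right; have [a ax|x1] := pickP [in tight mu x].
  have [x' [x'0 Sx' cx']] := shrink_tight mu0 x0 Sx ax bx.
  have [|Sx'E|//] := IH x' _ x'0 Sx'; first exact: leq_trans cx' _.
  (* An eigenvector [x'] would have all indices tight, yet it has fewer tight ones than [x]. *)
  suff x'T : tight mu x' = [set: 'I_n].
    by move: cx'; rewrite x'T cardsT ltnNge max_card.
  by apply/setP => i; rewrite !inE Sx'E mxE hpowE lexx.
by exists x => // i; rewrite ltNge; have := x1 i; rewrite !inE => ->.
Qed.

(** * Compactness and the minimum of the Collatz-Wielandt number *)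

Lemma subinvariant_bound_connect mu i j : 0 <= mu -> connect (tensor_edge S) i j ->
  forall B, exists C, forall x, (forall k, 1 <= x k 0) ->
    (forall k, tapply S x k 0 <= mu * x k 0 ^+ d.-1) ->
    x i 0 <= B -> x j 0 <= C.
Proof.
move=> mu0 /connectP[p]; elim: p i => [|k p IH] i /= => [_ -> B|].
  by exists B.
move=> /andP[/tensor_edgeP[s Ss ks] kp] jE B.
(* All factors being at least 1, [S i s * x_k <= S(x)_i <= mu B^(d-1)], which bounds [x_k] uniformly
   in [x]. *)
have [C HC] := IH k kp jE (mu * B ^+ d.-1 / S i s); exists C => x x1 Sx xB.
apply: HC => //; rewrite ler_pdivlMr//.
have x0 l : 0 <= x l 0 by apply: le_trans (x1 l).
apply: (@le_trans _ _ (mu * x i 0 ^+ d.-1)); last first.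
  by rewrite ler_wpM2l// lerXn2r ?nnegrE// (le_trans (x0 i)).
apply: le_trans (Sx i); apply: le_trans (ler_term_tapply i s x0).
rewrite mulrC ler_pM2l// (big_rem k ks)/= ler_peMr//.
apply: (@le_trans _ _ (\prod_(l <- rem k s) 1)); first by rewrite big1.
by apply: ler_prod => l _; rewrite ler01 x1.
Qed.

Lemma subinvariant_bound mu : 0 <= mu ->
  exists2 M : R, 1 <= M & forall x, (forall k, 1 <= x k 0) ->
    (forall k, tapply S x k 0 <= mu * x k 0 ^+ d.-1) ->
    (exists i, x i 0 <= 1) -> forall j, x j 0 <= M.
Proof.
move=> mu0.
have /choice[C HC] : forall ij : 'I_n * 'I_n, exists C, forall x,
    (forall k, 1 <= x k 0) ->
    (forall k, tapply S x k 0 <= mu * x k 0 ^+ d.-1) ->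
    x ij.1 0 <= 1 -> x ij.2 0 <= C.
  by move=> ij; apply: subinvariant_bound_connect.
exists (\big[Order.max/1]_ij C ij); first exact: bigmax_ge_id.
move=> x x1 Sx [i xi] j.
exact: le_trans (HC (i, j) x x1 Sx xi) (le_bigmax _ _ _).
Qed.

(** At positive [x] the quotients are nonnegative, so for [n >= 1] the seed 0 leaves their maximum
    unchanged. *)
Definition collatz_wielandt x : R :=
  \big[Order.max/0]_i (tapply S x i 0 / x i 0 ^+ d.-1).

Lemma collatz_wielandt_ge0 x : 0 <= collatz_wielandt x.
Proof. exact: bigmax_ge_id. Qed.

Lemma collatz_wielandt_le x mu : positive_vector x -> 0 <= mu ->
  (collatz_wielandt x <= mu) <->
  (forall i, tapply S x i 0 <= mu * x i 0 ^+ d.-1).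
Proof.
move=> x0 mu0; split => [h i|h].
  by rewrite -ler_pdivrMr ?exprn_gt0//; apply: le_trans h; exact: le_bigmax.
by apply: bigmax_le => // i _; rewrite ler_pdivrMr ?exprn_gt0.
Qed.

Lemma collatz_wielandtZ c x : c != 0 ->
  collatz_wielandt (c *: x) = collatz_wielandt x.
Proof.
move=> c0; apply: eq_bigr => i _; rewrite tapplyZ !mxE exprMn invfM mulrACA.
by rewrite divff ?mul1r// expf_neq0.
Qed.

Lemma collatz_wielandt_continuous (v : 'rV[R]_n) : positive_vector v^T ->
  {for v, continuous (fun v : 'rV[R]_n => collatz_wielandt v^T)}.
Proof.
move=> v0.
have vc k : ((w : 'rV[R]_n)^T k 0 @[w --> v] --> v^T k 0)%classic.
  by rewrite mxE; under eq_fun do rewrite mxE; exact: coord_continuous.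
apply: cvg_big; [exact: max_continuous | exact: nbhs_filter | move=> i _].
have xc : ((w : 'rV[R]_n)^T i 0 ^+ d.-1 @[w --> v] --> v^T i 0 ^+ d.-1)%classic.
  exact: (continuous_comp (vc i) (@exprn_continuous _ _ _)).
have xn0 : v^T i 0 ^+ d.-1 != 0 by rewrite expf_neq0// gt_eqF.
suff Sc : (tapply S (w : 'rV[R]_n)^T i 0 @[w --> v] --> tapply S v^T i 0)%classic.
  exact: cvgM Sc (cvgV xn0 xc).
rewrite tapplyE; under eq_fun do rewrite tapplyE.
apply: cvg_big; [exact: (@add_continuous R^o) | exact: nbhs_filter | move=> s _].
suff pc : (\prod_(k <- s) (w : 'rV[R]_n)^T k 0 @[w --> v] -->
           \prod_(k <- s) v^T k 0)%classic.
  exact: cvgM (cvg_cst _) pc.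
by apply: cvg_big; [exact: mul_continuous | exact: nbhs_filter |].
Qed.

(** The minimum over the box [[1, M]^n] is global: a vector either does no better than the all-ones
    vector [e], which is in the box, or lands in the box once its least coordinate is scaled to
    1. *)
Lemma collatz_wielandt_min : (0 < n)%N ->
  exists2 x, positive_vector x &
    forall x', positive_vector x' -> collatz_wielandt x <= collatz_wielandt x'.
Proof.
move=> n0; pose e : 'cV[R]_n := const_mx 1.
have e1 k : e k 0 = 1 by rewrite mxE.
have ee : positive_vector e by move=> k; rewrite e1.
have [M M1 HM] := subinvariant_bound (collatz_wielandt_ge0 e).
pose K : set 'rV[R]_n := [set v | forall i, `[1, M]%classic (v ord0 i)]%classic.
have Kpos (v : 'rV[R]_n) : K v -> positive_vector v^T.
  move=> Kv i; rewrite mxE; apply: lt_le_trans ltr01 _.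
  by have := Kv i; rewrite /= in_itv/= => /andP[].
have Ke : K e^T by move=> i; rewrite /= mxE e1 in_itv/= lexx.
have Kc : compact K.
  apply: (@rV_compact _ _ (fun=> `[1, M]%classic)) => _; exact: segment_compact.
have [|c] := @EVT_min_rV _ _ (fun v : 'rV[R]_n => collatz_wielandt v^T) K (ex_intro _ _ Ke) Kc.
  apply: continuous_in_subspaceT => v; rewrite inE => /Kpos.
  exact: collatz_wielandt_continuous.
rewrite inE => Kcc cmin; exists c^T; first exact: Kpos.
move=> x x0.
have ce : collatz_wielandt c^T <= collatz_wielandt e.
  by have := cmin e^T; rewrite inE trmxK; apply.
have [/(le_trans ce)//|/ltW xe] := leP (collatz_wielandt e) (collatz_wielandt x).
have [i _ imin] := @arg_minP _ _ _ (Ordinal n0) xpredT (fun i => x i 0) isT.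
have {}imin j : x i 0 <= x j 0 by exact: imin.
pose z := (x i 0)^-1 *: x.
have z1 k : 1 <= z k 0 by rewrite mxE mulrC ler_pdivlMr ?mul1r.
have zx : collatz_wielandt z = collatz_wielandt x.
  by rewrite collatz_wielandtZ// invr_eq0 gt_eqF.
have z0 : positive_vector z by move=> k; exact: lt_le_trans ltr01 (z1 k).
rewrite -zx -[z]trmxK; apply: cmin; rewrite inE => j /=.
rewrite mxE in_itv/= z1/=; apply: HM => //.
  by apply/collatz_wielandt_le; rewrite ?collatz_wielandt_ge0// zx.
by exists i; rewrite mxE mulVf// gt_eqF.
Qed.

Lemma positive_eigenvector_exists : (0 < n)%N ->
  exists v mu, [/\ positive_vector v, 0 <= mu & tapply S v = mu *: hpow v d.-1].
Proof.
move=> n0; have [v v0 vmin] := collatz_wielandt_min n0.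
set mu := collatz_wielandt v in vmin.
have mu0 : 0 <= mu := collatz_wielandt_ge0 v.
exists v, mu; split => //.
have Sv : forall i, tapply S v i 0 <= mu * v i 0 ^+ d.-1.
  exact/collatz_wielandt_le.
have [//|[x x0 Sx]] := subinvariant_eigenvector_or_strict mu0 v0 Sv.
(* [bigmax_lt] also compares the seed 0 with [mu], hence strict positivity. *)
have {}mu0 : 0 < mu.
  rewrite -(pmulr_lgt0 _ (exprn_gt0 d.-1 (x0 (Ordinal n0)))).
  by apply: le_lt_trans (Sx _); apply: tapply_ge0 => k; exact/ltW.
have := vmin x x0; rewrite leNgt => /negP[].
by apply: bigmax_lt => // i _; rewrite ltr_pdivrMr ?exprn_gt0.
Qed.

End NonnegativeTensor.

(** * Jensen's inequality and the Jacobian *)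

Lemma weighted_sum_le_of_expR (R : realType) (I : finType) (p h : I -> R) (L : R) :
  (forall s, 0 <= p s) -> \sum_s p s = 1 ->
  \sum_s p s * expR (h s) <= expR L -> \sum_s p s * h s <= L.
Proof.
move=> p0 p1 hL; rewrite -subr_le0 -(lerD2l 1) addr0.
have -> : 1 + (\sum_s p s * h s - L) = \sum_s p s * (1 + (h s - L)).
  under [RHS]eq_bigr do rewrite mulrDr mulrBr mulr1.
  by rewrite big_split /= sumrB -mulr_suml p1 mul1r.
(* Jensen for [expR], through its tangent line [1 + t <= expR t] at [t = h s - L]. *)
apply: (@le_trans _ _ (\sum_s p s * expR (h s - L))).
  by apply: ler_sum => s _; rewrite ler_wpM2l// expR_ge1Dx.
under eq_bigr do rewrite expRB mulrA.
by rewrite -mulr_suml ler_pdivrMr ?expR_gt0// mul1r.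
Qed.

(** Transposing position [t] with the head preserves [f], so all [m.+1] positions contribute
    equally. *)
Lemma sum_tuple_thead (R : comNzRingType) (I : finType) (m : nat)
    (f : m.+1.-tuple I -> R) (h : I -> R) :
  (forall s s' : m.+1.-tuple I, perm_eq s s' -> f s = f s') ->
  \sum_s f s * \sum_(k <- s) h k = m.+1%:R * \sum_s f s * h (thead s).
Proof.
move=> fS.
under eq_bigr do rewrite big_tuple mulr_sumr.
rewrite exchange_big /=.
transitivity (\sum_(t < m.+1) \sum_s f s * h (thead s)); last first.
  by rewrite sumr_const card_ord mulr_natl.
apply: eq_bigr => t _.
pose sw (s : m.+1.-tuple I) := [tuple tnth s (tperm ord0 t l) | l < m.+1].
have swK : involutive sw.
  by move=> s; apply: eq_from_tnth => l; rewrite !tnth_mktuple tpermK.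
rewrite (reindex_inj (inv_inj swK)); apply: eq_bigr => s _.
rewrite tnth_mktuple tpermR; congr (_ * _); apply: fS.
apply/tuple_permP; exists (tperm ord0 t).
by [].
Qed.

Section Jacobian.
Context {R : realType} {n d : nat}.
Hypothesis d_gt1 : (1 < d)%N.
Variable T : tensor R n d.
Implicit Types (u : 'cV[R]_n) (i j k : 'I_n).

(** Both sides are the derivative at [t = 0] of [T(u exp(t h))_i]: term by term on the left, by the
    chain rule on the right. *)
Lemma tjac_tangent u (h : 'I_n -> R) i : partially_symmetric T ->
  \sum_(s : (d.-1).-tuple 'I_n)
    T i s * \prod_(k <- s) u k 0 * \sum_(k <- s) h k =
  \sum_j tjac T u i j * (u j 0 * h j).
Proof.
case: d d_gt1 T => [|[|m]]//= _ T' T_ps.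
rewrite (@sum_tuple_thead _ _ m (fun s => T' i s * \prod_(k <- s) u k 0)); last first.
  by move=> s s' ss'; rewrite (T_ps _ _ _ ss') (perm_big _ ss').
rewrite (partition_big (@thead _ _) xpredT)//= mulr_sumr; apply: eq_bigr => j _.
rewrite mxE -mulrA; congr (_ * _); rewrite mulr_suml.
apply: eq_big => [s|s /eqP <-].
  by case/tupleP: s => a s; rewrite theadE.
by case/tupleP: s => a s; rewrite theadE /= big_cons; ring.
Qed.

(** Euler's identity for forms of degree [d - 1], the case [h = 1] of [tjac_tangent]. *)
Lemma tjac_mul u i : partially_symmetric T ->
  \sum_j tjac T u i j * u j 0 = (d.-1)%:R * tapply T u i 0.
Proof.
move=> T_ps; have := tjac_tangent u (fun=> 1) i T_ps.
under [in RHS]eq_bigr do rewrite mulr1.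
move=> <-; rewrite tapplyE mulr_sumr; apply: eq_bigr => s _.
by rewrite big_const_seq iter_addr_0 count_predT size_tuple mulrC.
Qed.

Lemma tjac_sym u i j : symmetric_tensor T -> tjac T u i j = tjac T u j i.
Proof.
case: d d_gt1 T => [|[|m]]//= _ T' T_sym.
rewrite !mxE; congr (_ * _).
(* [c a] replaces the head by [a], so [c j] and [c i] match the tuples headed by [i] with those
   headed by [j]. *)
pose c a (s : m.+1.-tuple 'I_n) : m.+1.-tuple 'I_n := [tuple of a :: behead s].
rewrite (reindex_onto (c j) (c i)) /=; last first.
  by move=> s; case/tupleP: s => a s /= /eqP[->]; exact: val_inj.
apply: eq_big => [s|s /andP[_ /eqP <-]].
  rewrite eqxx /=; case/tupleP: s => a s; rewrite -val_eqE /= eqseq_cons.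
  by rewrite eqxx andbT eq_sym.
congr (_ * _); apply: T_sym => /=.
by rewrite -[_ :: j :: _]/([:: i] ++ [:: j] ++ _) -[j :: i :: _]/([:: j] ++ [:: i] ++ _) perm_catCA.
Qed.

End Jacobian.

(** If [T(z)_i = 0] with [z > 0], then every [T i s] vanishes, and so does [T(x)_i]. *)
Lemma tapply_gt0_transfer (R : realType) (n d : nat) (T : tensor R n d)
    (x z : 'cV[R]_n) i :
  nonneg_tensor T -> (forall k, 0 <= x k 0) -> positive_vector z ->
  0 < tapply T x i 0 -> 0 < tapply T z i 0.
Proof.
move=> T0 x0 z0; rewrite !lt_def !tapply_ge0// => [|k]; last exact/ltW.
rewrite !andbT; apply: contraNneq => Tz.
rewrite tapplyE big1// => s _.
have : T i s * \prod_(k <- s) z k 0 == 0.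
  rewrite eq_le -[leRHS]Tz ler_term_tapply ?mulr_ge0//; last first.
  - by move=> k; exact/ltW.
  - by apply: prodr_ge0 => k _; exact/ltW.
by rewrite mulf_eq0 [X in _ || X]gt_eqF ?prodr_gt0// orbF => /eqP ->; rewrite mul0r.
Qed.

(** * Log-convexity and the bound for a positive eigenvector *)

Section LogConvexity.
Context {R : realType} {n d : nat}.
Variables (T : tensor R n d) (u w : 'cV[R]_n) (rho : R).
Hypothesis d_gt1 : (1 < d)%N.
Hypothesis T_ge0 : nonneg_tensor T.
Hypothesis T_ps : partially_symmetric T.
Hypothesis u_gt0 : positive_vector u.
Hypothesis rho_gt0 : 0 < rho.
Hypothesis u_eig : forall i, tapply T u i 0 = rho * u i 0 ^+ d.-1.
Hypothesis w_ge0 : forall i, 0 <= w i 0.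
Hypothesis w_eig : forall j,
  \sum_i u i 0 ^- (d - 2) * tjac T u i j * w i 0 = (d.-1)%:R * rho * w j 0.

(* Jensen: in the coordinates [h = ln (v / u)], the function [h |-> ln T(v)_i] is
   convex, hence above its tangent at [h = 0]. *)
Lemma ln_tapply_tangent (h : 'I_n -> R) (L : R) i :
  tapply T (\col_k (u k 0 * expR (h k))) i 0 = rho * u i 0 ^+ d.-1 * expR L ->
  (rho * u i 0 ^+ d.-1)^-1 * \sum_j tjac T u i j * (u j 0 * h j) <= L.
Proof.
move=> TL; have c0 : 0 < rho * u i 0 ^+ d.-1 by rewrite mulr_gt0 ?exprn_gt0.
rewrite -tjac_tangent// mulr_sumr.
under eq_bigr do rewrite mulrA.
(* The weights are the terms of [T(u)_i] divided by [rho u_i^(d-1)]; they sum to 1 by [u_eig]. *)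
apply: weighted_sum_le_of_expR => [s||].
- by rewrite mulr_ge0 ?invr_ge0 ?(ltW c0)// mulr_ge0// prodr_ge0// => k _; exact/ltW.
- by rewrite -mulr_sumr -tapplyE u_eig mulVf// gt_eqF.
- rewrite -(ler_pM2l c0) -TL mulr_sumr tapplyE; apply: ler_sum => s _.
  rewrite expR_sum !mulrA divff ?gt_eqF// mul1r -mulrA -big_split /=.
  by under [in leRHS]eq_bigr do rewrite mxE.
Qed.

(* The weights [u i * w i] make the gradient of [h |-> \sum_i u i * w i * ln
   (T(v)_i / v_i ^ (d-1))] vanish at [h = 0]. *)
Lemma weighted_ln_le (h L : 'I_n -> R) :
  (forall i, tapply T (\col_k (u k 0 * expR (h k))) i 0 =
             rho * u i 0 ^+ d.-1 * expR (L i)) ->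
  (d.-1)%:R * \sum_j u j 0 * w j 0 * h j <= \sum_i u i 0 * w i 0 * L i.
Proof.
move=> TL.
have -> : (d.-1)%:R * \sum_j u j 0 * w j 0 * h j =
    \sum_i u i 0 * w i 0 *
      ((rho * u i 0 ^+ d.-1)^-1 * \sum_j tjac T u i j * (u j 0 * h j)).
  under [RHS]eq_bigr do rewrite mulrA mulr_sumr.
  rewrite exchange_big mulr_sumr /=; apply: eq_bigr => j _.
  (* Since [u_i / u_i^(d-1) = u_i^-(d-2)], the coefficient of [u_j h_j] is the left side of [w_eig],
     up to [rho^-1]. *)
  transitivity (rho^-1 * (\sum_i u i 0 ^- (d - 2) * tjac T u i j * w i 0) *
                (u j 0 * h j)).
    by rewrite w_eig; field; rewrite gt_eqF.
  rewrite mulr_sumr mulr_suml; apply: eq_bigr => i _.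
  have -> : d.-1 = (d - 2).+1 by lia.
  by rewrite exprS; field; rewrite !gt_eqF// exprn_gt0.
apply: ler_sum => i _; apply: ler_wpM2l; last exact: ln_tapply_tangent.
by rewrite mulr_ge0// ltW.
Qed.

Lemma diag_eigenvalue_ge (y v : 'cV[R]_n) (r : R) :
  w^T *m u = 1%:M -> positive_vector y -> positive_vector v -> 0 < r ->
  tapply (diag_tensor y T) v = r *: hpow v d.-1 ->
  rho * \prod_i (y i 0 `^ (u i 0 * w i 0)) <= r.
Proof.
move=> wu y_gt0 v_gt0 r_gt0 v_eig.
have uw1 : \sum_i u i 0 * w i 0 = 1.
  have := congr1 (fun A : 'M[R]_1 => A 0 0) wu; rewrite mxE [in RHS]mxE eqxx mulr1n => <-.
  by apply: eq_bigr => i _; rewrite mxE mulrC.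
pose h k := ln (v k 0 / u k 0).
have vE k : v k 0 = u k 0 * expR (h k).
  by rewrite lnK ?posrE ?divr_gt0// mulrC divfK// gt_eqF.
(* [L i] is [ln (T(v)_i / T(u)_i)], computed from the two eigenvector equations. *)
pose L i := ln (r / rho) - ln (y i 0) + (d.-1)%:R * h i.
have /weighted_ln_le : forall i, tapply T (\col_k (u k 0 * expR (h k))) i 0 =
             rho * u i 0 ^+ d.-1 * expR (L i).
  move=> i; have -> : \col_k (u k 0 * expR (h k)) = v.
    by apply/colP => k; rewrite mxE vE.
  have := tapply_eigen i v_eig; rewrite tapply_diag => yT.
  have -> : tapply T v i 0 = r * v i 0 ^+ d.-1 / y i 0.
    by rewrite -yT mulrC mulKf// gt_eqF.
  rewrite expRD expRB !lnK ?posrE ?divr_gt0// expRM_natl vE exprMn.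
  by field; rewrite !gt_eqF.
(* The terms in [(d-1) h] cancel, leaving [\sum_i u_i w_i ln y_i <= ln (r / rho)]. *)
under [leRHS]eq_bigr do rewrite mulrDr.
rewrite big_split /= mulr_sumr.
under [X in _ <= _ + X -> _]eq_bigr do rewrite mulrCA.
rewrite -lerBlDr subrr.
under eq_bigr do rewrite mulrBr.
rewrite sumrB -mulr_suml uw1 mul1r subr_ge0 => hL.
have -> : \prod_i (y i 0 `^ (u i 0 * w i 0)) =
    expR (\sum_i u i 0 * w i 0 * ln (y i 0)).
  by rewrite expR_sum; apply: eq_bigr => i _; rewrite /powR gt_eqF.
rewrite mulrC -ler_pdivlMr// -[leRHS]lnK ?posrE ?divr_gt0//.
by rewrite ler_expR.
Qed.

End LogConvexity.

(** * Deduction of the two inequalities *)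

Lemma scaled_jacE (R : realType) (n d : nat) (T : tensor R n d) (u : 'cV[R]_n) i j :
  scaled_jac T u i j = u i 0 ^- (d - 2) * tjac T u i j.
Proof. by rewrite /scaled_jac mul_diag_mx !mxE. Qed.

Theorem theorem8 (R : realType) (n d : nat) (hn : (1 <= n)%N) (hd : (3 <= d)%N)
    (T : tensor R n d) (T_ge0 : nonneg_tensor T) (T_ps : partially_symmetric T)
    (T_irr : weakly_irreducible T)
    (u : 'cV[R]_n) (u_gt0 : positive_vector u)
    (u_eig : tapply T u = spectral_radius T *: hpow u d.-1)
    (y : 'cV[R]_n) (y_gt0 : positive_vector y) :
  (forall w : 'cV[R]_n, positive_vector w ->
     (scaled_jac T u)^T *m w = ((d.-1)%:R * spectral_radius T) *: w ->
     w^T *m u = 1%:M ->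
     spectral_radius T * \prod_(i < n) (y i 0 `^ (u i 0 * w i 0))
       <= spectral_radius (diag_tensor y T))
  /\
  (symmetric_tensor T -> \sum_(i < n) u i 0 ^+ d = 1 ->
     spectral_radius T * \prod_(i < n) (y i 0 `^ (u i 0 ^+ d))
       <= spectral_radius (diag_tensor y T)).
Proof.
have main w : positive_vector w ->
     (scaled_jac T u)^T *m w = ((d.-1)%:R * spectral_radius T) *: w ->
     w^T *m u = 1%:M ->
     spectral_radius T * \prod_(i < n) (y i 0 `^ (u i 0 * w i 0))
       <= spectral_radius (diag_tensor y T).
  move=> w_gt0 w_eig wu; have := spectral_radius_ge0 T.
  (* The logarithms require [rho(T) > 0]; if it is 0, the left side vanishes. *)
  rewrite le_eqVlt => /predU1P[<-|rho_gt0].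
    by rewrite mul0r spectral_radius_ge0.
  have u_eigE i := tapply_eigen i u_eig.
  have w_eigE j : \sum_i u i 0 ^- (d - 2) * tjac T u i j * w i 0 =
      (d.-1)%:R * spectral_radius T * w j 0.
    have := congr1 (fun z : 'cV[R]_n => z j 0) w_eig; rewrite mxE [in RHS]mxE => <-.
    by apply: eq_bigr => i _; rewrite [in RHS]mxE scaled_jacE.
  have S_ge0 : nonneg_tensor (diag_tensor y T).
    by move=> i s; rewrite mulr_ge0// ltW.
  (* Scaling by [y > 0] leaves the digraph unchanged. *)
  have S_irr : weakly_irreducible (diag_tensor y T).
    move=> i j; rewrite -(@eq_connect _ (tensor_edge T)) => [|a b]; first exact: T_irr.
    by apply: eq_existsb => s; rewrite /diag_tensor pmulr_rgt0.
  have [v [r [v_gt0 r_ge0 v_eig]]] := positive_eigenvector_exists S_ge0 S_irr hn.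
  rewrite (positive_eigenvector_spectral_radius S_ge0 hn v_gt0 r_ge0 v_eig).
  have r_gt0 : 0 < r.
    pose i : 'I_n := Ordinal hn.
    rewrite -(pmulr_lgt0 _ (exprn_gt0 d.-1 (v_gt0 i))).
    rewrite -(tapply_eigen i v_eig) tapply_diag mulr_gt0//.
    apply: (@tapply_gt0_transfer _ _ _ _ u) => // [k|]; first exact/ltW.
    by rewrite u_eigE mulr_gt0 ?exprn_gt0.
  apply: (diag_eigenvalue_ge _ T_ge0 T_ps u_gt0 rho_gt0 u_eigE _ w_eigE wu y_gt0
    v_gt0 r_gt0 v_eig); first exact: ltnW.
  by move=> i; exact/ltW.
split=> // T_sym u1.
have dE : d = d.-1.+1 by lia.
(* By symmetry of the Jacobian, [(A^T w)_j = \sum_i DT(u)_ji u_i], which Euler's identity evaluates;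
   [w^T u = 1] becomes [\sum_i u_i^d = 1]. *)
pose w := hpow u d.-1.
have uw i : u i 0 ^+ d = u i 0 * w i 0 by rewrite hpowE -exprS -dE.
under eq_bigr do rewrite uw.
apply: main.
- by move=> i; rewrite hpowE exprn_gt0.
- apply/colP => j; rewrite mxE [RHS]mxE.
  transitivity (\sum_i tjac T u j i * u i 0).
    apply: eq_bigr => i _; rewrite mxE scaled_jacE tjac_sym// ?(ltnW hd)//.
    rewrite hpowE; have -> : d.-1 = (d - 2).+1 by lia.
    by rewrite exprS; field; rewrite expf_neq0// gt_eqF.
  by rewrite tjac_mul ?(ltnW hd)// (tapply_eigen j u_eig) hpowE mulrA.
- apply/matrixP => a b; rewrite !ord1 mxE [RHS]mxE eqxx -u1.
  by apply: eq_bigr => i _; rewrite uw mxE mulrC.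
Qed.
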